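(* Let $L_\psi>0$ and let $\phi:\mathbb{R}^N\to\mathbb{R}\cup\{+\infty\}$ be a proper, lower semicontinuous, $\rho$-weakly convex function with $\rho=1-\frac1{L_\psi}$ and with prox-bound $\lambda_\phi>1$ (so that $\mathrm{prox}_\phi$ is $L_\psi$-Lipschitz continuous). Let $\psi$ be the convex potential with $\nabla\psi=\mathrm{prox}_\phi$, and let $g_e$ be an $\epsilon$-type (e) approximation of $\mathrm{prox}_\phi$. Then $$\forall x\in\mathrm{dom}\,\psi,\quad \|g_e(x)-\mathrm{prox}_\phi(x)\|\le\sqrt{2L_\psi\epsilon} .$$ In particular, if fixed points of $g_e$ exist, $$\forall\bar x\in\mathrm{Fix}\,g_e,\quad \|\bar x-\mathrm{prox}_\phi(\bar x)\|\le\sqrt{2L_\psi\epsilon} .$$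
   Context: $\phi$ is $\rho$-weakly convex if $\phi+\frac{\rho}{2}\|\cdot\|^2$ is convex. The prox-bound $\lambda_\phi$ is the supremum of all $\lambda>0$ such that $\inf_{x}\{\phi(x)+\frac1{2\lambda}\|x-y\|^2\}>-\infty$ for some $y\in\mathbb{R}^N$. The proximal operator is $\mathrm{prox}_\phi(y)=\operatorname{argmin}_{x\in\mathbb{R}^N}\{\phi(x)+\frac12\|x-y\|^2\}$. In this setting it is the gradient of a continuously differentiable convex function $\psi:\mathbb{R}^N\to\mathbb{R}$, unique up to an additive constant. The $\epsilon$-subdifferential of a convex function $\psi$ at $x$ is $\partial_\epsilon\psi(x)=\{s : \psi(x)+\langle s,y-x\rangle-\epsilon\le\psi(y)\ \text{ for all }y\}$. $g_e$ is an $\epsilon$-type (e) approximation of $\mathrm{prox}_\phi$ if $g_e(y)\in\partial_\epsilon\psi(y)$ for all $y\in\mathbb{R}^N$. $\mathrm{Fix}\,g=\{x : g(x)=x\}$. *)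

(* Defs.v *)
From mathcomp Require Import all_boot all_order all_algebra.
From mathcomp Require Import all_classical all_reals all_analysis.

Set Implicit Arguments.
Unset Strict Implicit.
Unset Printing Implicit Defensive.

Import Order.TTheory GRing.Theory Num.Theory.
Import numFieldNormedType.Exports.

Local Open Scope classical_set_scope.
Local Open Scope ring_scope.

Section Definitions.
Context {R : realType} {N : nat}.
Implicit Types (x y s : 'rV[R]_N) (phi : 'rV[R]_N -> \bar R)
  (psi : 'rV[R]_N -> R) (g : 'rV[R]_N -> 'rV[R]_N).

Definition dotv x y : R := \sum_(i < N) x 0 i * y 0 i.

(* The library norm `|x| on row vectors is the sup norm, hence this one. The
   two are equivalent, so topological notions can be taken from the library. *)
Definition enorm x : R := Num.sqrt (dotv x x).

Definition eproper phi : Prop :=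
  (forall x, phi x != -oo%E) /\ exists x, (phi x < +oo)%E.

(* Intended for f with values in ]-oo, +oo]. The endpoints t = 0 and t = 1 are
   harmless because 0 * +oo = 0 in \bar R. *)
Definition econvex (f : 'rV[R]_N -> \bar R) : Prop :=
  forall x y (t : R), 0 <= t <= 1 ->
    (f (t *: x + (1 - t) *: y)%R <= t%:E * f x + (1 - t)%:E * f y)%E.

(* rho may have any sign. *)
Definition weakly_convex (rho : R) phi : Prop :=
  econvex (fun x => phi x + (rho / 2 * enorm x ^+ 2)%:E)%E.

Definition prox_bound phi : \bar R :=
  ereal_sup [set lam%:E | lam in [set lam : R | 0 < lam /\ exists y,
    (-oo < ereal_inf
       (range (fun x => phi x + ((2 * lam)^-1 * enorm (x - y) ^+ 2)%:E)))%E]].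

Definition prox_argmin phi y : set 'rV[R]_N :=
  [set x | forall z, (phi x + (2^-1 * enorm (x - y) ^+ 2)%:E
                      <= phi z + (2^-1 * enorm (z - y) ^+ 2)%:E)%E].

(* The minimizer, as a function of y. For phi proper, lower semicontinuous and
   rho-weakly convex with rho < 1 and with prox-bound > 1, [prox_argmin phi y]
   is a singleton for every y, so the default value 0 is never used. *)
Definition prox phi y : 'rV[R]_N := xget 0 (prox_argmin phi y).

Definition gradient psi x : 'rV[R]_N :=
  \row_(i < N) 'D_(delta_mx 0 i) psi x.

Definition convex_potential psi g : Prop :=
  [/\ convex_function setT psi,
      forall x, differentiable psi x,
      continuous (gradient psi) &
      forall x, gradient psi x = g x].

Definition eps_subdiff (eps : R) psi x : set 'rV[R]_N :=
  [set s | forall y, psi x + dotv s (y - x) - eps <= psi y].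

(* psi is a convex potential of the operator that g approximates. *)
Definition type_e_approx (eps : R) psi g : Prop :=
  forall y, eps_subdiff eps psi y (g y).

Definition fixed_points g : set 'rV[R]_N := [set x | g x = x].

End Definitions.

(* Main.v *)
Require Import Defs.
From mathcomp Require Import all_boot all_order all_algebra.
From mathcomp Require Import all_classical all_reals all_analysis.
From mathcomp Require Import ring lra.
Import Order.TTheory GRing.Theory Num.Theory.
Import numFieldNormedType.Exports.
Local Open Scope classical_set_scope.
Local Open Scope ring_scope.

(** Write L for the Lipschitz constant and p = prox phi.

    A function with L-Lipschitz gradient p lies below the paraboloid
    psi x + <p x, y - x> + L/2 |y - x|^2 ([descent_lemma]), whereas an
    eps-subgradient s at x gives the affine minorant
    psi x + <s, y - x> - eps.  The two bounds are compatible only if s is close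
    to p x: at y = x + (s - p x)/L, where the gap between the affine function
    and the paraboloid is largest, they give |s - p x|^2 <= 2 L eps
    ([eps_subdiff_gradient_dist]).

    It remains to see that p is L-Lipschitz.  Since phi is weakly convex with
    constant 1 - 1/L, the objective phi + |. - y|^2/2 that defines the proximal
    point of y is 1/L-strongly convex ([prox_objective_strongly_convex]).
    Hence it grows quadratically away from its minimizer
    ([prox_argmin_growth]), and adding the growth inequalities at two proximal
    points gives |p x - p y|^2 <= L <p x - p y, x - y>
    ([prox_argmin_cocoercive]).

    This uses that p x really is a minimizer.  A prox-bound above 1 makes the
    objective bounded below ([prox_objective_lower_bound]); strong convexity
    makes every minimizing sequence Cauchy, and lower semicontinuity makes its
    limit a minimizer ([prox_argmin_nonempty]). *)

Set Implicit Arguments.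
Unset Strict Implicit.

(** * The Euclidean inner product on row vectors *)

Section EuclideanDot.
Context {R : realType} {N : nat}.
Implicit Types x y z : 'rV[R]_N.

Lemma dotvC x y : dotv x y = dotv y x.
Proof. by apply: eq_bigr => i _; rewrite mulrC. Qed.

Lemma dotvDl x y z : dotv (x + y) z = dotv x z + dotv y z.
Proof. by rewrite -big_split; apply: eq_bigr => i _; rewrite mxE mulrDl. Qed.

Lemma dotvZl (a : R) x y : dotv (a *: x) y = a * dotv x y.
Proof. by rewrite mulr_sumr; apply: eq_bigr => i _; rewrite mxE mulrA. Qed.

Lemma dotvNl x y : dotv (- x) y = - dotv x y.
Proof. by rewrite -scaleN1r dotvZl mulN1r. Qed.

Lemma dotvDr x y z : dotv z (x + y) = dotv z x + dotv z y.
Proof. by rewrite !(dotvC z) dotvDl. Qed.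

Lemma dotvZr (a : R) x y : dotv x (a *: y) = a * dotv x y.
Proof. by rewrite !(dotvC x) dotvZl. Qed.

Lemma dotvNr x y : dotv x (- y) = - dotv x y.
Proof. by rewrite !(dotvC x) dotvNl. Qed.

Definition dotvE := (dotvDl, dotvDr, dotvZl, dotvZr, dotvNl, dotvNr).

Lemma dotvv_ge0 x : 0 <= dotv x x.
Proof. by apply: sumr_ge0 => i _; rewrite -expr2 sqr_ge0. Qed.

Lemma enorm_sqr x : enorm x ^+ 2 = dotv x x.
Proof. by rewrite /enorm sqr_sqrtr ?dotvv_ge0. Qed.

Lemma sqr_coord_le_dotvv x (i : 'I_N) : x 0 i ^+ 2 <= dotv x x.
Proof.
rewrite /dotv (bigD1 i) //= -expr2 lerDl.
by apply: sumr_ge0 => j _; rewrite -expr2 sqr_ge0.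
Qed.

Lemma cvg_dotvv (u : nat -> 'rV[R]_N) x y : u @ \oo --> x ->
  dotv (u n - y) (u n - y) @[n --> \oo] --> dotv (x - y) (x - y).
Proof.
move=> ux; rewrite /dotv; apply: cvg_big => [|i _]; first exact: add_continuous.
have cu : (u n 0 i) @[n --> \oo] --> x 0 i.
  exact: (cvg_comp _ _ ux (@coord_continuous R 1 N 0 i x)).
have cuy : ((u n - y) 0 i) @[n --> \oo] --> (x - y) 0 i.
  under eq_fun do rewrite !mxE.
  by rewrite !mxE; apply: cvgB cu _; exact: cvg_cst.
exact: cvgM.
Qed.

End EuclideanDot.

(** * Existence and cocoercivity of proximal points *)

Section Prox.
Context {R : realType} {N : nat}.
Implicit Types (x y z p q : 'rV[R]_N) (phi : 'rV[R]_N -> \bar R).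

(** The quadratic |.|^2/2 satisfies the convexity inequality with the exact
    defect t (1 - t) |q - p|^2 / 2.  Weak convexity of phi may spend a fraction
    1 - 1/L of it, which leaves the defect of a 1/L-strongly convex function. *)
Lemma prox_objective_strongly_convex (L : R) phi y p q (a b t : R) :
  weakly_convex (1 - L^-1) phi -> phi p = a%:E -> phi q = b%:E ->
  0 <= t <= 1 ->
  (phi (t *: q + (1 - t) *: p)%R
     + (2^-1 * enorm (t *: q + (1 - t) *: p - y) ^+ 2)%:E
   <= (t * (b + 2^-1 * enorm (q - y) ^+ 2)
       + (1 - t) * (a + 2^-1 * enorm (p - y) ^+ 2)
       - t * (1 - t) * (2 * L)^-1 * enorm (q - p) ^+ 2)%:E)%E.
Proof.
move=> wc pa qb t01; have := wc q p t t01.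
rewrite pa qb !enorm_sqr -!EFinD.
case: (phi _) => [c| |] //=; last by rewrite !leNye.
rewrite !lee_fin invfM !dotvE.
rewrite (dotvC p q) (dotvC y q) (dotvC y p).
set l := L^-1; nra.
Qed.

Lemma prox_argmin_fin_num phi y p : eproper phi -> prox_argmin phi y p ->
  exists a, phi p = a%:E.
Proof.
move=> [phiNy [z zfin]] /(_ z); have := phiNy p.
case: (phi p) => [a| |] // _; first by exists a.
by case: (phi z) zfin.
Qed.

(** Strong convexity along the segment from the minimizer p to q, compared with
    minimality of p and divided by t, bounds (1 - t) |q - p|^2 / (2L) by the
    increase of the objective; then t tends to 0. *)
Lemma prox_argmin_growth (L : R) phi y p q (a b : R) :
  0 < L -> weakly_convex (1 - L^-1) phi -> prox_argmin phi y p ->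
  phi p = a%:E -> phi q = b%:E ->
  a + 2^-1 * enorm (p - y) ^+ 2 + (2 * L)^-1 * enorm (q - p) ^+ 2
    <= b + 2^-1 * enorm (q - y) ^+ 2.
Proof.
move=> L0 wc pmin pa qb.
set A := a + _; set B := b + _; set c := _ * enorm (q - p) ^+ 2.
have slope t : 0 < t <= 1 -> (1 - t) * c <= B - A.
  move=> /andP[t0 t1].
  have t01 : 0 <= t <= 1 by rewrite ltW.
  have := le_trans (pmin _) (prox_objective_strongly_convex y wc pa qb t01).
  rewrite pa -EFinD lee_fin -/A -/B -!mulrA -/c => h.
  rewrite -(ler_pM2l t0); lra.
have BA : 0 <= B - A by have := slope 1; rewrite subrr mul0r; apply; lra.
have c0 : 0 <= c by rewrite mulr_ge0 ?sqr_ge0 // invr_ge0 mulr_ge0 // ltW.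
rewrite leNgt; apply/negP => lt_c.
have c_gt0 : 0 < c by lra.
(* With this t, (1 - t) c is the midpoint of B - A and c, so [slope] fails if
   B - A < c. *)
pose t := (c - (B - A)) / (2 * c).
have tc : t * c = (c - (B - A)) / 2 by rewrite /t; field; rewrite gt_eqF.
have t01 : 0 < t <= 1.
  rewrite divr_gt0 ?ler_pdivrMr ?mul1r //; lra.
by have := slope t t01; lra.
Qed.

(** Sum of the growth inequalities of p against q and of q against p: the values
    of phi cancel and the squared distances combine to <p - q, x - y>. *)
Lemma prox_argmin_cocoercive (L : R) phi x y p q :
  0 < L -> eproper phi -> weakly_convex (1 - L^-1) phi ->
  prox_argmin phi x p -> prox_argmin phi y q ->
  dotv (p - q) (p - q) <= L * dotv (p - q) (x - y).
Proof.
move=> L0 phip wc pmin qmin.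
have [a pa] := prox_argmin_fin_num phip pmin.
have [b qb] := prox_argmin_fin_num phip qmin.
have := prox_argmin_growth L0 wc pmin pa qb.
have := prox_argmin_growth L0 wc qmin qb pa.
rewrite -ler_pdivrMl // !enorm_sqr invfM !dotvE.
rewrite (dotvC q p) (dotvC x q) (dotvC x p) (dotvC y p) (dotvC y q).
set l := L^-1; lra.
Qed.

(** Cocoercivity gives the Lipschitz bound, in the inner-product form that the
    descent lemma takes: expand 0 <= |p - L x|^2 and bound |p|^2. *)
Lemma cocoercive_le (L : R) x p :
  0 < L -> dotv p p <= L * dotv p x -> dotv p x <= L * dotv x x.
Proof.
move=> L0 coco; rewrite -(ler_pM2l L0).
have := dotvv_ge0 (p - L *: x); rewrite !dotvE (dotvC x p); lra.
Qed.

(** The prox-bound supplies some lam > 1 and w for which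
    phi + |. - w|^2 / (2 lam) is bounded below.  Passing to the weight 1/2
    leaves a positive multiple c of |. - w|^2, and this absorbs the linear term
    that appears when the centre moves from w to y. *)
Lemma prox_objective_lower_bound phi y :
  (1 < prox_bound phi)%E ->
  exists b : R, forall x, (b%:E <= phi x + (2^-1 * enorm (x - y) ^+ 2)%:E)%E.
Proof.
move=> /ereal_sup_gt[_ [lam [lam0 [w low]] <-]]; rewrite lte_fin => lam1.
set I := ereal_inf _ in low.
have [b bI] : exists b : R, (b%:E <= I)%E.
  by case: I low => [b _|_|] //; [exists b | exists 0; rewrite leey].
pose c := 2^-1 - (2 * lam)^-1.
have c0 : 0 < c.
  rewrite subr_gt0 ltf_pV2 ?posrE; lra.
pose k := (2 * c)^-1.
exists (b + 2^-1 * (1 - k) * dotv (w - y) (w - y)) => x.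
have := le_trans bI (ereal_inf_lbound (imageT _ x)).
have ck : c * k = 2^-1 by rewrite /k; field; rewrite gt_eqF.
rewrite !enorm_sqr; case: (phi x) => [a| |] //=; last by rewrite !addye ?leey.
rewrite -!EFinD !lee_fin.
have -> : (2 * lam)^-1 = 2^-1 - c by rewrite /c opprB addrCA subrr addr0.
have -> : x - y = (x - w) + (w - y) by rewrite addrA subrK.
move: (x - w) (w - y) => u v.
(* completing the square: |v|^2 k / 2 is what c |u|^2 + <u, v> can lose *)
have : 0 <= c * dotv u u + dotv u v + 2^-1 * k * dotv v v.
  have -> : c * dotv u u + dotv u v + 2^-1 * k * dotv v v
            = c * dotv (u + k *: v) (u + k *: v).
    have -> : dotv u v = 2 * (c * k) * dotv u v by rewrite ck; field.
    rewrite -ck !dotvE (dotvC v u); ring.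
  by rewrite mulr_ge0 ?dotvv_ge0 // ltW.
rewrite !dotvE (dotvC v u); lra.
Qed.

(** Strong convexity at midpoints bounds the distance between two almost
    minimizers by their excess over the infimum, so that a minimizing sequence
    is Cauchy.  Completeness gives a limit, and lower semicontinuity of phi puts
    its objective value at or below the infimum. *)
Lemma prox_argmin_nonempty (L : R) phi y :
  0 < L -> eproper phi -> lower_semicontinuous phi ->
  weakly_convex (1 - L^-1) phi -> (1 < prox_bound phi)%E ->
  exists p, prox_argmin phi y p.
Proof.
move=> L0 [phiNy [z0 z0fin]] lsc wc /(prox_objective_lower_bound y)[b lowb].
pose F x := (phi x + (2^-1 * enorm (x - y) ^+ 2)%:E)%E.
pose I := ereal_inf (range F).
have Ifin : I \is a fin_num.
  rewrite fin_numElt; apply/andP; split.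
    apply: (@lt_le_trans _ _ b%:E); first exact: ltNyr.
    by apply: le_ereal_inf_tmp => _ [x _ <-]; exact: lowb.
  apply: (@le_lt_trans _ _ (F z0)).
    by apply: ereal_inf_lbound; exists z0.
  by rewrite /F; case: (phi z0) z0fin => //= r _; rewrite -EFinD ltry.
have [m Im] : exists m, I = m%:E by exists (fine I); rewrite fineK.
have mF x : (m%:E <= F x)%E.
  by rewrite -Im; apply: ereal_inf_lbound; exists x.
have minseq n : exists xa : 'rV[R]_N * R, phi xa.1 = xa.2%:E /\
    xa.2 + 2^-1 * enorm (xa.1 - y) ^+ 2 < m + harmonic n.
  have [_ [x _ <-]] := lb_ereal_inf_adherent (@harmonic_gt0 R n) Ifin.
  rewrite -/I Im /F; have := phiNy x.
  case E : (phi x) => [a| |] // _; rewrite -!EFinD lte_fin => h.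
  by exists (x, a).
have [ua uaP] := choice minseq.
pose u n := (ua n).1; pose a n := (ua n).2.
have ua_phi n : phi (u n) = (a n)%:E by have [] := uaP n.
have ua_lt n : a n + 2^-1 * enorm (u n - y) ^+ 2 < m + harmonic n.
  by have [] := uaP n.
(* the midpoint of u n and u k cannot do better than the infimum m *)
have u_close n k :
    dotv (u n - u k) (u n - u k) <= 4 * L * (harmonic n + harmonic k).
  have t01 : 0 <= (2^-1 : R) <= 1 by lra.
  have := le_trans (mF _)
    (prox_objective_strongly_convex y wc (ua_phi k) (ua_phi n) t01).
  rewrite lee_fin (enorm_sqr (u n - u k)) => h.
  rewrite -(ler_pM2l (_ : 0 < L^-1)) ?invr_gt0 //.
  have -> : L^-1 * (4 * L * (harmonic n + harmonic k))
            = 4 * (harmonic n + harmonic k) :> R.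
    by field; rewrite gt_eqF.
  have hn := ua_lt n; have hk := ua_lt k.
  move: h; rewrite invfM; set l := L^-1; set d := dotv _ _; lra.
have u_cauchy : cauchy_ball (u @ \oo).
  move=> e e0; pose del := e ^+ 2 / (8 * L).
  have del0 : 0 < del by rewrite divr_gt0 ?exprn_gt0 ?mulr_gt0.
  have small : \forall n \near \oo, harmonic n < del.
    by apply: cvgr_lt del0; exact: cvg_harmonic.
  pose A := u @` [set n | harmonic n < del].
  have uA : \forall n \near \oo, A (u n).
    by move: small; apply: filterS => n h; exists n.
  exists (A, A) => // -[_ _] /= [[n hn <-] [k hk <-]]; split=> // i j.
  rewrite (ord1 i) /ball /= -(@ltr_pXn2r _ 2) ?nnegrE ?normr_ge0 ?ltW //.
  rewrite real_normK ?num_real //.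
  have := sqr_coord_le_dotvv (u n - u k) j; rewrite !mxE.
  move=> /le_trans /(_ (u_close n k)) /le_lt_trans; apply.
  have -> : e ^+ 2 = 4 * L * (del + del) by rewrite /del; field; rewrite gt_eqF.
  by rewrite ltr_pM2l ?mulr_gt0 // ltrD.
have [x ux] : exists x, u @ \oo --> x.
  by have /cauchy_ballP /cauchy_cvgP /cvg_ex := u_cauchy.
exists x => z; apply: le_trans (mF z); rewrite leNgt; apply/negP => lt_mx.
(* If the limit x is not a minimizer, some r < phi x still exceeds the value
   m - |x - y|^2/2 that minimality would require; near x, hence along u, phi
   stays above r. *)
have [r rphi rm] : exists2 r : R,
    (r%:E < phi x)%E & m < r + 2^-1 * enorm (x - y) ^+ 2.
  have := phiNy x; move: lt_mx; case: (phi x) => [c| |] //=.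
    rewrite -EFinD lte_fin => h _.
    exists ((m - 2^-1 * enorm (x - y) ^+ 2 + c) / 2); rewrite ?lte_fin; lra.
  move=> _ _; exists (m + 1 - 2^-1 * enorm (x - y) ^+ 2); rewrite ?ltry //; lra.
have [V Vx rV] := lsc x r rphi.
have cF : r + 2^-1 * dotv (u n - y) (u n - y) - harmonic n @[n --> \oo]
    --> r + 2^-1 * dotv (x - y) (x - y) - 0.
  apply: cvgB; last exact: cvg_harmonic.
  apply: cvgD; first exact: cvg_cst.
  by apply: cvgM; [exact: cvg_cst | exact: cvg_dotvv].
suff : r + 2^-1 * dotv (x - y) (x - y) - 0 <= m by rewrite -enorm_sqr; lra.
apply: cvgr_to_le cF _.
have unV : \forall n \near \oo, V (u n) := ux _ Vx.
move: unV; apply: filterS => n /rV; rewrite ua_phi lte_fin => h.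
have := ua_lt n; rewrite enorm_sqr; lra.
Qed.

End Prox.

(** * Upper paraboloids and approximate subgradients *)

Section Descent.
Context {R : realType} {N : nat}.
Implicit Types (x y d : 'rV[R]_N) (psi : 'rV[R]_N -> R).

Lemma derive_gradient psi x d : differentiable psi x ->
  'D_d psi x = dotv (gradient psi x) d.
Proof.
move=> dpsi; rewrite deriveE // [X in 'd psi x X]row_sum_delta linear_sum.
apply: eq_bigr => i _.
by rewrite linearZ /= mxE deriveE // mulrC.
Qed.

Lemma is_derive_line psi x d (t : R) : differentiable psi (x + t *: d) ->
  is_derive t 1 (fun s : R => psi (x + s *: d))
    (dotv (gradient psi (x + t *: d)) d).
Proof.
move=> dpsi; have dd : derivable psi (x + t *: d) d by exact: diff_derivable.
(* both sides are the difference quotient of psi at x + t d, with step h d *)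
have E : (fun h : R => h^-1 *:
           (((fun s : R => psi (x + s *: d)) \o shift t) (h *: (1 : R))
            - psi (x + t *: d)))
       = (fun h : R => h^-1 *:
           ((psi \o shift (x + t *: d)) (h *: d) - psi (x + t *: d))).
  apply/funext => h /=; congr (_ *: (psi _ - _)).
  by rewrite [h *: (1 : R)]mulr1 scalerDl addrCA.
split; first by rewrite /derivable E.
by rewrite /derive E -/(derive psi _ _) derive_gradient.
Qed.

(** On the segment x + t d with d = y - x, the difference of psi and the
    paraboloid touching it at x has derivative
    <grad psi (x + t d) - grad psi x, d> - L |d|^2 t <= 0, so it cannot increase
    from t = 0 to t = 1. *)
Lemma descent_lemma (L : R) psi :
  (forall x, differentiable psi x) ->
  (forall x y, dotv (gradient psi x - gradient psi y) (x - y)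
     <= L * dotv (x - y) (x - y)) ->
  forall x y, psi y <= psi x + dotv (gradient psi x) (y - x)
                       + L / 2 * dotv (y - x) (y - x).
Proof.
move=> dpsi Lpsi x y; set d := y - x.
pose g := gradient psi x.
pose k (t : R) := psi (x + t *: d) - t * dotv g d - L / 2 * dotv d d * t ^+ 2.
pose dk (t : R) :=
  dotv (gradient psi (x + t *: d)) d - dotv g d - L * dotv d d * t.
have kE (t : R) : is_derive t (1 : R) k (dk t).
  have h := is_derive_line (dpsi (x + t *: d)).
  apply: is_derive_eq.
  by rewrite /dk scaler0 add0r /GRing.scale /=; field.
have kc : {within `[0, 1], continuous k}.
  apply: derivable_within_continuous => t _; exact: ex_derive.
have [c c01 kdiff] := @MVT_segment R k dk 0 1 ler01 (fun t _ => kE t) kc.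
have dk_le0 : dk c <= 0.
  have := Lpsi (x + c *: d) x; rewrite [x + _ - x]addrAC subrr add0r.
  (* c = 0 is separate, as the inequality for d is obtained by dividing by c *)
  move: c01; rewrite in_itv /= => /andP[].
  rewrite le_eqVlt => /orP[/eqP <- _ _|c0 _].
    by rewrite /dk scale0r addr0 -/g subrr mulr0 subrr.
  rewrite !dotvZr dotvZl mulrCA ler_pM2l // dotvDl dotvNl -/g /dk; lra.
have x1 : x + 1 *: d = y by rewrite scale1r addrC subrK.
have x0 : x + 0 *: d = x by rewrite scale0r addr0.
by move: kdiff; rewrite subr0 mulr1 /k x1 x0; lra.
Qed.

(** Both bounds on psi are evaluated at x + (s - grad psi x) / L, the maximizer
    of <s - grad psi x, y - x> - L/2 |y - x|^2. *)
Lemma eps_subdiff_gradient_dist (L eps : R) psi x s :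
  0 < L ->
  (forall y, psi y <= psi x + dotv (gradient psi x) (y - x)
                      + L / 2 * dotv (y - x) (y - x)) ->
  eps_subdiff eps psi x s ->
  enorm (s - gradient psi x) <= Num.sqrt (2 * L * eps).
Proof.
move=> L0 desc sub; rewrite /enorm ler_wsqrtr //.
set g := gradient psi x in desc *.
have := desc (x + L^-1 *: (s - g)); have := sub (x + L^-1 *: (s - g)).
rewrite [x + _ - x]addrAC subrr add0r => h1 h2.
have := le_trans h1 h2; move: (psi x) => c h.
rewrite -(ler_pM2l (_ : 0 < L^-1)) ?invr_gt0 //.
have -> : L^-1 * (2 * L * eps) = 2 * eps by field; rewrite gt_eqF.
move: h; rewrite !dotvZr dotvZl.
have -> : dotv s (s - g) = dotv g (s - g) + dotv (s - g) (s - g).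
  by rewrite -dotvDl addrCA subrr addr0.
have -> : L / 2 * (L^-1 * (L^-1 * dotv (s - g) (s - g))) =
  L^-1 * dotv (s - g) (s - g) / 2 by field; rewrite gt_eqF.
lra.
Qed.

End Descent.

(** * Error of approximate proximal operators *)

Theorem proposition17 (R : realType) (N : nat) (Lpsi eps : R)
    (phi : 'rV[R]_N -> \bar R) (psi : 'rV[R]_N -> R)
    (ge : 'rV[R]_N -> 'rV[R]_N)
    (Lpsi_gt0 : 0 < Lpsi)
    (phi_proper : eproper phi)
    (phi_lsc : lower_semicontinuous phi)
    (phi_wconvex : weakly_convex (1 - Lpsi^-1) phi)
    (phi_bound : (1 < prox_bound phi)%E)
    (psi_potential : convex_potential psi (prox phi))
    (ge_approx : type_e_approx eps psi ge) :
  (forall x : 'rV[R]_N, enorm (ge x - prox phi x) <= Num.sqrt (2 * Lpsi * eps))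
  /\
  (forall xbar : 'rV[R]_N, fixed_points ge xbar ->
     enorm (xbar - prox phi xbar) <= Num.sqrt (2 * Lpsi * eps)).
Proof.
have [_ psi_diff _ psi_grad] := psi_potential.
have proxP x : prox_argmin phi x (prox phi x).
  by apply: xgetPex; exact: prox_argmin_nonempty phi_wconvex phi_bound.
have grad_lip x y : dotv (gradient psi x - gradient psi y) (x - y)
    <= Lpsi * dotv (x - y) (x - y).
  rewrite !psi_grad; apply: cocoercive_le => //.
  exact: prox_argmin_cocoercive (proxP x) (proxP y).
have dist x : enorm (ge x - prox phi x) <= Num.sqrt (2 * Lpsi * eps).
  rewrite -psi_grad; apply: eps_subdiff_gradient_dist => //.
  exact: descent_lemma.
by split=> // xbar fix_xbar; rewrite -{1}fix_xbar.
Qed.
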